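(* Let $(\mathcal A,\varphi)$ be a $\mathcal B$-valued noncommutative probability space and $\mathcal S=(\mathcal U,\tilde\varphi,(\iota^{(i)})_{i\ge1})$ a spreadability system for it. Cumulants for $\mathcal S$ are uniquely determined by the axioms (S1)--(S3) given in the context. That is, if $(K_\pi)$ and $(K'_\pi)$, both indexed by $\pi\in\bigcup_{n\ge1}\mathcal{OP}_n$, are two families of functionals satisfying (S1)--(S3) (with possibly different universal coefficients), then $K_\pi=K'_\pi$ for all $n\in\mathbb N$ and $\pi\in\mathcal{OP}_n$.
   Context: Ordered set partitions. $\mathbb N=\{1,2,\dots\}$, $[n]=\{1,\dots,n\}$. An ordered set partition of a finite set $A$ is a sequence $\pi=(P_1,\dots,P_p)$ of pairwise disjoint nonempty subsets (blocks) with union $A$; $|\pi|=p$; $\mathcal{OP}_n$ is the set of ordered set partitions of $[n]$. $\bar\pi=\{P_1,\dots,P_p\}$ is the underlying set partition; set partitions are ordered by refinement ($\bar\pi\le\bar\sigma$ iff each block of $\bar\pi$ is contained in a block of $\bar\sigma$). For $\pi=(P_1,\dots,P_p)$, $\sigma=(S_1,\dots,S_s)$ we write $\pi\le\sigma$ iff $\bar\pi\le\bar\sigma$ and, whenever $i<j$, $P_i\subseteq S_k$, $P_j\subseteq S_l$, one has $k\le l$. The quasi-meet is $\pi\curlywedge\sigma=(P_1\cap S_1,P_1\cap S_2,\dots,P_1\cap S_s,P_2\cap S_1,\dots,P_p\cap S_s)$ with empty sets removed. The ordered kernel $\kappa(i_1,\dots,i_n)\in\mathcal{OP}_n$ has as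 blocks the level sets $\{k\in[n]:i_k=v\}$, listed in increasing order of the value $v$. Spreadability systems. Algebras are associative over $\mathbb C$. A $\mathcal B$-valued noncommutative probability space is an algebra $\mathcal A$ with a linear map $\varphi:\mathcal A\to\mathcal B$ into an algebra $\mathcal B$. A spreadability system for $(\mathcal A,\varphi)$ is a triple $(\mathcal U,\tilde\varphi,(\iota^{(i)})_{i\ge1})$ with $\mathcal U$ an algebra, $\tilde\varphi:\mathcal U\to\mathcal B$ linear, $\iota^{(i)}:\mathcal A\to\mathcal U$ homomorphisms with $\varphi=\tilde\varphi\circ\iota^{(i)}$, such that, writing $X^{(i)}=\iota^{(i)}(X)$, $\tilde\varphi(X_1^{(i_1)}\cdots X_n^{(i_n)})=\tilde\varphi(X_1^{(h(i_1))}\cdots X_n^{(h(i_n))})$ for all $X_k\in\mathcal A$, $i_k\in\mathbb N$ and all $h:\{i_1,\dots,i_n\}\to\mathbb N$ with $i_p<i_q\Rightarrow h(i_p)<h(i_q)$. For $\pi\in\mathcal{OP}_n$, $\varphi_\pi(X_1,\dots,X_n):=\tilde\varphi(X_1^{(i_1)}\cdots X_n^{(i_n)})$ for any $(i_1,\dots,i_n)$ with $\kappa(i_1,\dots,i_n)=\pi$. One extends $\varphi_\pi(X_1^{(i_1)},\dots,X_n^{(i_n)}):=\varphi_{\pi\curlywedge\kappa(i_1,\dots,i_n)}(X_1,\dots,X_n)$ and $\varphi_\pi(N_1.X_1,\dots,N_n.X_n):=\sum_{i_1=1}^{N_1}\cdots\sum_{i_n=1}^{N_n}\varphi_\pi(X_1^{(i_1)},\dots,X_n^{(i_n)})$.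 Axioms for cumulants. (S1) For each $n\in\mathbb N$, $\pi\in\mathcal{OP}_n$, $K_\pi:\mathcal A^n\to\mathcal B$ is multilinear. (S2) There are coefficients $c(\sigma,\pi)\in\mathbb C$ (depending only on $\sigma,\pi$) such that $\varphi_\pi=K_\pi+\sum_{\sigma\in\mathcal{OP}_n,\sigma<\pi}c(\sigma,\pi)K_\sigma$ for every $\pi\in\mathcal{OP}_n$; equivalently, there are $\tilde c(\sigma,\pi)\in\mathbb C$ with $K_\pi=\varphi_\pi+\sum_{\sigma<\pi}\tilde c(\sigma,\pi)\varphi_\sigma$. (S3) (Extensivity) $K_\pi(N.X_1,\dots,N.X_n)=N^{|\pi|}K_\pi(X_1,\dots,X_n)$ for all $X_k\in\mathcal A$, $N\in\mathbb N$, $\pi\in\mathcal{OP}_n$, where $K_\pi(N_1.X_1,\dots,N_n.X_n):=\sum_{\sigma\le\pi}\tilde c(\sigma,\pi)\varphi_\sigma(N_1.X_1,\dots,N_n.X_n)$ with $\tilde c(\pi,\pi)=1$. *)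

(* Defs.v *)
From HB Require Import structures.
From mathcomp Require Import all_boot all_order all_algebra.
From mathcomp Require Import reals.
From mathcomp Require Import complex.

Set Implicit Arguments.
Unset Strict Implicit.
Unset Printing Implicit Defensive.

Import GRing.Theory.

Section OrderedSetPartitions.
Variable T : finType.
Implicit Types (s t : seq {set T}) (x : T).

Definition is_osp s :=
  [&& all (fun B => B != set0) s,
      pairwise (fun B C : {set T} => [disjoint B & C]) s
    & \bigcup_(B <- s) B == setT].

Definition hits x s := count (fun B : {set T} => x \in B) s.

Lemma hits_gt0 x s : (0 < hits x s) = (x \in \bigcup_(B <- s) B).
Proof.
rewrite /hits; elim: s => [|B s IHs] /=; first by rewrite big_nil inE.
by rewrite big_cons inE -IHs; case: (x \in B).
Qed.

Lemma pairwise_hits s :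
  pairwise (fun B C : {set T} => [disjoint B & C]) s
    <-> forall x, hits x s <= 1.
Proof.
elim: s => [|B s IHs] /=; first by split.
have dBs : all (fun C : {set T} => [disjoint B & C]) s
    <-> forall x, x \in B -> hits x s = 0.
  split=> [/allP dB x xB|h0].
    apply/eqP; rewrite -leqn0 leqNgt -has_count; apply/hasPn => C /dB dBC.
    by rewrite (disjointFr dBC xB).
  apply/allP => C Cs; rewrite disjoint_subset; apply/subsetP => x xB.
  rewrite inE; apply/negP => xC.
  suff: 0 < hits x s by rewrite h0.
  by rewrite -has_count; apply/hasP; exists C.
split=> [/andP[/dBs h0 /IHs h1] x|h1].
  rewrite /hits /= -/(hits x s); case: (boolP (x \in B)) => [/h0 -> //|_].
  by rewrite add0n.
apply/andP; split.
  apply/dBs => x xB; apply/eqP; rewrite -leqn0 -ltnS.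
  by have:= h1 x; rewrite /hits /= xB.
by apply/IHs => x; apply: leq_trans (h1 x); rewrite /hits /= leq_addl.
Qed.

Lemma is_ospP s :
  is_osp s <-> all (fun B => B != set0) s /\ forall x, hits x s = 1.
Proof.
split=> [/and3P[ne /pairwise_hits h1 /eqP cov]|[ne h1]].
  split=> // x; apply/eqP; rewrite eqn_leq h1 hits_gt0 cov; exact: in_setT.
apply/and3P; split=> //; first by apply/pairwise_hits => x; rewrite h1.
by apply/eqP/setP => x; rewrite -hits_gt0 h1 inE.
Qed.

Lemma is_osp_size s : is_osp s -> size s <= #|T|.
Proof.
move=> /is_ospP[/allP ne h1].
have -> : #|T| = \sum_(B <- s) #|B|.
  rewrite -sum1_card; under [RHS]eq_bigr do rewrite -sum1_card big_mkcond.
  rewrite exchange_big /=; apply: eq_bigr => x _.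
  by rewrite -big_mkcond /= sum1_count -[LHS](h1 x).
rewrite -sum1_size big_seq [leqRHS]big_seq; apply: leq_sum => B /ne.
by rewrite card_gt0.
Qed.

Record osp := Osp { blocks :> seq {set T}; blocksP : is_osp blocks }.

HB.instance Definition _ := [isSub for blocks].
HB.instance Definition _ := [Choice of osp by <:].

Definition osp_bseq (p : osp) : #|T|.-bseq {set T} :=
  Bseq (is_osp_size (blocksP p)).

Lemma osp_bseqK : pcancel osp_bseq (insub : seq {set T} -> option osp).
Proof. by move=> p; rewrite /= valK. Qed.

HB.instance Definition _ : isCountable osp := PCanIsCountable osp_bseqK.
HB.instance Definition _ : isFinite osp := PCanIsFinite osp_bseqK.

Implicit Types p q : osp.

Definition ople p q : bool :=
  all (fun P : {set T} => has (fun S : {set T} => P \subset S) q) p &&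
  [forall i : 'I_(size p), forall j : 'I_(size p),
   forall k : 'I_(size q), forall l : 'I_(size q),
     [&& i < j, nth set0 p i \subset nth set0 q k
       & nth set0 p j \subset nth set0 q l] ==> (k <= l)].

Definition oplt p q : bool := (p != q) && ople p q.

Definition qmeet_seq s t : seq {set T} :=
  [seq B <- [seq P :&: Q | P <- s, Q <- t] | B != set0].

Lemma hits_ne x s : hits x [seq B <- s | B != set0] = hits x s.
Proof.
rewrite /hits count_filter; apply: eq_count => B /=.
by case: (boolP (x \in B)) => //= xB; apply/set0Pn; exists x.
Qed.

Lemma hits_qmeet x s t : hits x (qmeet_seq s t) = hits x s * hits x t.
Proof.
rewrite hits_ne /hits; elim: s => //= P s IHs.
rewrite count_cat mulnDl IHs count_map; congr (_ + _).
case: (boolP (x \in P)) => xP.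
  by rewrite mul1n; apply: eq_count => B; rewrite /= inE xP.
rewrite (eq_count (a2 := pred0)) ?count_pred0 // => B.
by rewrite /= inE (negPf xP).
Qed.

Lemma qmeet_subproof p q : is_osp (qmeet_seq p q).
Proof.
apply/is_ospP; split=> [|x]; first exact: filter_all.
rewrite hits_qmeet.
by case/is_ospP: (blocksP p) (blocksP q) => _ -> /is_ospP[_ ->].
Qed.

Definition qmeet p q : osp := Osp (qmeet_subproof p q).

Implicit Type i : T -> nat.

Definition values i : seq nat := sort leq (undup (codom i)).

Definition okernel_seq i : seq {set T} :=
  [seq [set x | i x == v] | v <- values i].

Lemma mem_values i x : i x \in values i.
Proof. by rewrite mem_sort mem_undup codom_f. Qed.

Lemma okernel_subproof i : is_osp (okernel_seq i).
Proof.
apply/is_ospP; split=> [|x].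
  apply/allP => B /mapP[v]; rewrite mem_sort mem_undup => /codomP[x ->] ->.
  by apply/set0Pn; exists x; rewrite inE.
rewrite /hits count_map (eq_count (a2 := pred1 (i x))); last first.
  by move=> v; rewrite /= inE eq_sym.
by rewrite count_uniq_mem ?mem_values // sort_uniq undup_uniq.
Qed.

Definition okernel i : osp := Osp (okernel_subproof i).

(* The 1-based position in [p] of the block containing [x]. *)
Definition opos p x : nat := (find (fun B : {set T} => x \in B) p).+1.

Lemma opos_okernel i x : opos (okernel i) x = (index (i x) (values i)).+1.
Proof.
rewrite /opos /= /okernel_seq find_map; congr _.+1; apply: eq_find => v /=.
by rewrite inE eq_sym.
Qed.

Lemma osp_has p x : has (fun B : {set T} => x \in B) p.
Proof.
rewrite has_count -/(hits x p).
by case/is_ospP: (blocksP p) => _ ->.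
Qed.

Lemma osp_uniq_block p x k :
  k < size p -> x \in nth set0 p k -> find (fun B : {set T} => x \in B) p = k.
Proof.
move=> kp xk; have fp := osp_has p x; have xf := nth_find set0 fp.
rewrite has_find in fp; have /and3P[_ /(pairwiseP set0) dp _] := blocksP p.
set m := find _ _ in fp xf *.
case: (ltngtP m k) => // [mk|km].
  by have := dp m k fp kp mk => /disjointFr /(_ xf); rewrite xk.
by have := dp k m kp fp km => /disjointFr /(_ xk); rewrite xf.
Qed.

Lemma okernelK p : okernel (opos p) = p.
Proof.
apply: val_inj; rewrite /= /okernel_seq.
have -> : values (opos p) = iota 1 (size p).
  apply: (sorted_eq leq_trans anti_leq).
  - exact: sort_sorted leq_total _.
  - exact: iota_sorted.
  rewrite perm_sort; apply: uniq_perm; rewrite ?undup_uniq ?iota_uniq //.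
  move=> v; rewrite mem_undup mem_iota; apply/codomP/idP => [[x ->]|].
    by rewrite /opos /= add1n ltnS -has_find osp_has.
  case: v => // v; rewrite /= add1n ltnS => vp.
  have /and3P[/allP ne _ _] := blocksP p.
  have /set0Pn[x xv] := ne _ (mem_nth set0 vp).
  by exists x; rewrite /opos (osp_uniq_block vp xv).
apply: (@eq_from_nth _ set0); rewrite size_map size_iota // => k kp.
rewrite (nth_map 0) ?size_iota // nth_iota // add1n.
apply/setP => x; rewrite inE eqSS; apply/eqP/idP => [<-|xk].
  exact: nth_find (osp_has p x).
exact: osp_uniq_block.
Qed.

End OrderedSetPartitions.

Local Open Scope ring_scope.

HB.mixin Record Lmodule_isAssocAlgebra (F : fieldType) V of GRing.Lmodule F V := {
  amul : V -> V -> V;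
  amulA : associative amul;
  amul_linearl : forall y, linear (fun x => amul x y);
  amul_linearr : forall x, linear (fun y => amul x y)
}.

#[short(type="assocAlgType")]
HB.structure Definition AssocAlgebra (F : fieldType) :=
  { V of GRing.Lmodule F V & Lmodule_isAssocAlgebra F V }.

(* Algebras need not be unital; without a unit only nonempty words have a product, hence length [n.+1]. *)
Definition word (F : fieldType) (U : assocAlgType F) n
    (x : 'I_n.+1 -> U) : U :=
  foldl amul (x ord0) [seq x (lift ord0 k) | k <- enum 'I_n].

Definition multilinear (F : fieldType) (V W : lmodType F) n
    (f : {ffun 'I_n -> V} -> W) :=
  forall (X : {ffun 'I_n -> V}) (k : 'I_n),
    linear (fun x => f [ffun j => if j == k then x else X j]).

(* Superscripts range over the positive integers: [emb 0] is a junk value, and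
   [h] is a total function of which only the values at the [i k] matter. *)
Record spreadability_system (F : fieldType) (A B : assocAlgType F)
    (phi : {linear A -> B}) := SpreadabilitySystem {
  spU : assocAlgType F;
  sphi : {linear spU -> B};
  emb : nat -> {linear A -> spU};
  embM : forall i, (0 < i)%N -> {morph emb i : x y / amul x y};
  sphi_emb : forall i, (0 < i)%N -> forall x, phi x = sphi (emb i x);
  spreadable : forall n (X : 'I_n.+1 -> A) (i : 'I_n.+1 -> nat) (h : nat -> nat),
    (forall k, 0 < i k)%N ->
    (forall k, 0 < h (i k))%N ->
    (forall p q, i p < i q -> h (i p) < h (i q))%N ->
    sphi (word (fun k => emb (i k) (X k)))
      = sphi (word (fun k => emb (h (i k)) (X k)))
}.

Section Cumulants.
Variables (F : fieldType) (A B : assocAlgType F) (phi : {linear A -> B}).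
Variable Sp : spreadability_system phi.

(* [opos p] is a positive index sequence with ordered kernel [p] ([okernelK]);
   by [phi_ospE] any other such sequence gives the same value. *)
Definition phi_osp n (p : osp 'I_n.+1) (X : {ffun 'I_n.+1 -> A}) : B :=
  sphi Sp (word (fun k => emb Sp (opos p k) (X k))).

Lemma phi_ospE n (i : 'I_n.+1 -> nat) (X : {ffun 'I_n.+1 -> A}) :
  (forall k, 0 < i k)%N ->
  phi_osp (okernel i) X = sphi Sp (word (fun k => emb Sp (i k) (X k))).
Proof.
move=> i_gt0; pose h m := nth 0%N (values i) m.-1.
have hE k : h (opos (okernel i) k) = i k.
  by rewrite opos_okernel /h /= nth_index // mem_values.
rewrite /phi_osp (@spreadable _ _ _ _ Sp n X (opos (okernel i)) h) //.
- congr (sphi Sp _); rewrite /word hE; congr foldl.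
  by apply: eq_map => k /=; rewrite hE.
- by move=> k; rewrite hE.
move=> p q; rewrite !hE !opos_okernel ltnS => lt_pq.
have sv : sorted leq (values i) by exact: sort_sorted leq_total _.
have := sorted_leq_nth leq_trans leqnn 0%N sv _ _ _ _ (ltnW lt_pq).
rewrite !inE !index_mem !mem_values !nth_index ?mem_values // => /(_ isT isT).
rewrite leq_eqVlt => /orP[/eqP eq_pq|//].
by rewrite eq_pq ltnn in lt_pq.
Qed.

(* phi_pi(X_1^(i_1), ..., X_n^(i_n)) *)
Definition phi_osp_ind n (p : osp 'I_n.+1) (X : {ffun 'I_n.+1 -> A})
    (i : 'I_n.+1 -> nat) : B :=
  phi_osp (qmeet p (okernel i)) X.

(* phi_pi(N_1.X_1, ..., N_n.X_n); [(i k).+1] runs through 1, ..., N_k. *)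
Definition phi_osp_dot n (p : osp 'I_n.+1) (N : 'I_n.+1 -> nat)
    (X : {ffun 'I_n.+1 -> A}) : B :=
  \sum_(i : {dffun forall k : 'I_n.+1, 'I_(N k)})
    phi_osp_ind p X (fun k => (i k).+1).

Definition functionals := forall n, osp 'I_n.+1 -> {ffun 'I_n.+1 -> A} -> B.

(* [c n s p] is the coefficient c(s, p) for ordered partitions of [n.+1]. *)
Definition coefficients := forall n, osp 'I_n.+1 -> osp 'I_n.+1 -> F.

Definition cumulant_S1 (K : functionals) :=
  forall n (p : osp 'I_n.+1), multilinear (K n p).

Definition cumulant_S2 (K : functionals) (c : coefficients) :=
  forall n (p : osp 'I_n.+1) X,
    phi_osp p X = K n p X + \sum_(s | oplt s p) c n s p *: K n s X.

Definition cumulant_S2inv (K : functionals) (c' : coefficients) :=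
  forall n (p : osp 'I_n.+1) X,
    K n p X = phi_osp p X + \sum_(s | oplt s p) c' n s p *: phi_osp s X.

(* K_pi(N_1.X_1, ..., N_n.X_n) *)
Definition cumulant_dot (c' : coefficients) n (p : osp 'I_n.+1)
    (N : 'I_n.+1 -> nat) (X : {ffun 'I_n.+1 -> A}) : B :=
  \sum_(s | ople s p) c' n s p *: phi_osp_dot s N X.

Definition cumulant_S3 (K : functionals) (c' : coefficients) :=
  forall n (p : osp 'I_n.+1) (N : nat) X, (0 < N)%N ->
    cumulant_dot c' p (fun=> N) X = N%:R ^+ size p *: K n p X.

Definition is_cumulants (K : functionals) :=
  cumulant_S1 K /\
  (exists c, cumulant_S2 K c) /\
  (exists c' : coefficients,
    [/\ forall n (p : osp 'I_n.+1), c' n p p = 1,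
        cumulant_S2inv K c' & cumulant_S3 K c']).

End Cumulants.

(* Main.v *)
Require Import Defs.
From mathcomp Require Import all_boot all_order all_algebra.
From mathcomp Require Import reals complex.

(** Extensivity forces the dependence of [phi_pi(N.X, ..., N.X)] on [N].
    Isolating the leading term of the definition of [K_pi(N.X, ..., N.X)] in
    (S3), where the coefficient of [phi_pi] is 1, gives
      [phi_pi(N.X) = N^|pi| K_pi(X) - sum_(sigma < pi) c'(sigma, pi) phi_sigma(N.X)].
    A strict refinement has strictly more blocks ([oplt_size]), so downward
    induction on the number of blocks shows that [phi_pi(N.X)] is a polynomial
    in [N] with coefficients in [B], divisible by [N^|pi|], whose coefficient
    of [N^|pi|] is [K_pi(X)] ([phi_osp_dot_poly]).

    The left-hand side does not involve the cumulants. A polynomial with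
    coefficients in a vector space over a field of characteristic zero is
    determined by its values at the positive integers ([eq_coef_nat]), by
    invertibility of Vandermonde matrices. Hence [K_pi(X)], being a coefficient
    of [phi_pi(N.X)], is determined by the spreadability system alone, even if
    the universal coefficients are not. *)

Set Implicit Arguments.
Unset Strict Implicit.
Unset Printing Implicit Defensive.

Import GRing.Theory.

Section Refinement.
Variable T : finType.
Implicit Types (p q : osp T) (x : T).

Let block_of p x := find (fun B : {set T} => x \in B) p.

Lemma block_of_lt p x : block_of p x < size p.
Proof. by rewrite -has_find osp_has. Qed.

Lemma osp_block_neq0 p k : k < size p -> exists x, x \in nth set0 p k.
Proof.
move=> kp; have /and3P[/allP ne _ _] := blocksP p.
by apply/set0Pn/ne/mem_nth.
Qed.

Lemma osp_subset_block p k x q l : l < size q -> x \in nth set0 p k ->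
  nth set0 p k \subset nth set0 q l -> l = block_of q x.
Proof.
by move=> lq xk /subsetP/(_ x xk) xl; rewrite /block_of (osp_uniq_block lq xl).
Qed.

Lemma ople_refl p : ople p p.
Proof.
apply/andP; split; first by apply/allP => B Bp; apply/hasP; exists B.
apply/forallP => i; apply/forallP => j; apply/forallP => k; apply/forallP => l.
apply/implyP => /and3P[ij ik jl].
have [x xi] := osp_block_neq0 (ltn_ord i).
have [y yj] := osp_block_neq0 (ltn_ord j).
rewrite (osp_subset_block (ltn_ord k) xi ik).
rewrite (osp_subset_block (ltn_ord l) yj jl).
by rewrite /block_of !(osp_uniq_block _ xi, osp_uniq_block _ yj) ?ltn_ord // ltnW.
Qed.

Lemma eq_opos p q : opos p =1 opos q -> p = q.
Proof.
move=> E; rewrite -(okernelK p) -(okernelK q); apply: val_inj => /=.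
rewrite /okernel_seq /values (eq_codom E); apply: eq_map => v.
by apply/setP => x; rewrite !inE E.
Qed.

(** The map sending each block of [p] to the block of [q] that contains it is
    nondecreasing and onto; if [p] does not have more blocks than [q], such a
    map can only be the identity, and then [p = q]. *)
Lemma oplt_size p q : oplt p q -> size q < size p.
Proof.
case/andP=> neq_pq /andP[/allP sub_pq /forallP mono_pq].
rewrite ltnNge; apply: contraNN neq_pq => le_pq.
pose g k := find (fun S : {set T} => nth set0 p k \subset S) q.
have g_lt k : k < size p -> g k < size q.
  by move=> kp; rewrite -has_find; apply/sub_pq/mem_nth.
have g_sub k : k < size p -> nth set0 p k \subset nth set0 q (g k).
  by move=> kp; apply: (nth_find set0 (sub_pq _ (mem_nth set0 kp))).
have g_block x : g (block_of p x) = block_of q x.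
  have kp := block_of_lt p x.
  exact: osp_subset_block (g_lt _ kp) (nth_find set0 (osp_has p x)) (g_sub _ kp).
have g_mono i j : i < j -> j < size p -> g i <= g j.
  move=> ij jp; have ip := ltn_trans ij jp.
  have /forallP/(_ (Ordinal jp)) := mono_pq (Ordinal ip).
  move=> /forallP/(_ (Ordinal (g_lt _ ip)))/forallP/(_ (Ordinal (g_lt _ jp))).
  by move=> /implyP; apply; rewrite /= ij !g_sub.
pose s := [seq g k | k <- iota 0 (size p)].
have sub_s : {subset iota 0 (size q) <= s}.
  move=> l; rewrite mem_iota add0n /= => lq.
  have [x xl] := osp_block_neq0 lq.
  apply/mapP; exists (block_of p x); first by rewrite mem_iota block_of_lt.
  by rewrite g_block /block_of (osp_uniq_block lq xl).
have size_s : size s <= size (iota 0 (size q)) by rewrite size_map !size_iota.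
have uniq_s := leq_size_uniq (iota_uniq _ _) sub_s size_s.
have [eq_size eq_mem] := uniq_min_size (iota_uniq _ _) sub_s size_s.
have sorted_s : sorted leq s.
  apply/(sortedP 0) => k; rewrite size_map size_iota => kp.
  rewrite !(nth_map 0) ?size_iota ?(ltnW kp) // !nth_iota ?(ltnW kp) //.
  exact: g_mono.
have s_iota : s = iota 0 (size q).
  apply: (sorted_eq leq_trans anti_leq) => //; first exact: iota_sorted.
  by apply: uniq_perm; rewrite ?iota_uniq // => l; rewrite eq_mem.
have g_id k : k < size p -> g k = k.
  move=> kp; have := congr1 (nth 0 ^~ k) s_iota.
  rewrite (nth_map 0) ?size_iota // !nth_iota //.
  by rewrite -[X in _ < X](size_iota 0) eq_size size_map size_iota.
apply/eqP/eq_opos => x; congr _.+1.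
by rewrite -[RHS]g_block g_id ?block_of_lt.
Qed.

End Refinement.

Local Open Scope ring_scope.

Section PolynomialFunctions.
Variables (F : fieldType) (V : lmodType F).

(** The inverse of the Vandermonde matrix of the points [a] recovers the
    coefficients as linear combinations of the values. *)
Lemma vandermonde_coef0 m (a : 'I_m -> F) (b : 'I_m -> V) : injective a ->
    (forall j, \sum_(i < m) a j ^+ i *: b i = 0) ->
  forall k, b k = 0.
Proof.
move=> inj_a sum0 k; pose M := Vandermonde m (\row_j a j).
have unitM : M \in unitmx.
  rewrite unitmxE det_Vandermonde unitfE.
  apply/prodf_neq0 => i _; apply/prodf_neq0 => j lt_ij.
  rewrite !mxE subr_eq0 (inj_eq inj_a).
  by apply: contraTneq lt_ij => ->; rewrite ltnn.
have -> : b k = \sum_i (M *m invmx M) i k *: b i.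
  rewrite mulmxV // (bigD1 k) //= mxE eqxx scale1r big1 ?addr0 // => i neq_ik.
  by rewrite mxE (negPf neq_ik) scale0r.
under eq_bigr do rewrite mxE scaler_suml.
rewrite exchange_big big1 // => j _ /=.
transitivity (invmx M j k *: \sum_(i < m) a j ^+ i *: b i).
  rewrite scaler_sumr; apply: eq_bigr => i _.
  by rewrite scalerA !mxE mulrC.
by rewrite sum0 scaler0.
Qed.

Lemma eq_coef_nat m (b b' : nat -> V) : [pchar F] =i pred0 ->
    (forall N, (0 < N)%N ->
       \sum_(k < m) N%:R ^+ k *: b k = \sum_(k < m) N%:R ^+ k *: b' k) ->
  forall k, (k < m)%N -> b k = b' k.
Proof.
move=> char0 eq_bb' k km; apply/eqP; rewrite -subr_eq0; apply/eqP.
pose a (j : 'I_m) : F := j.+1%:R.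
apply: (@vandermonde_coef0 m a (fun i => b i - b' i) _ _ (Ordinal km)).
  have natr0 := (pcharf0P F).1 char0.
  have inj_le (i j : 'I_m) : (i <= j)%N -> a i = a j -> i = j.
    move=> le_ij /esym/eqP; rewrite -subr_eq0 -natrB // natr0 subSS => le_ji.
    by apply/val_inj/eqP; rewrite eqn_leq le_ij.
  move=> i j eq_a; case: (leqP i j) => [/inj_le|/ltnW/inj_le/(_ (esym eq_a))//].
  exact.
move=> j; under eq_bigr do rewrite scalerBr.
by rewrite sumrB eq_bb' // subrr.
Qed.

End PolynomialFunctions.

(** Downward induction on the number of blocks, solving the definition of
    [K_pi(N.X)] for its leading term [phi_pi(N.X)]. The degree bound [n.+1] is
    the largest possible number of blocks. *)
Lemma phi_osp_dot_poly (F : fieldType) (A B : assocAlgType F)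
    (phi : {linear A -> B}) (S : spreadability_system phi)
    (K : functionals A B) (c : coefficients F)
    (cpp : forall n (p : osp 'I_n.+1), c n p p = 1) (S3 : cumulant_S3 S K c)
    n (X : {ffun 'I_n.+1 -> A}) (p : osp 'I_n.+1) :
  exists b : nat -> B,
    [/\ forall N, (0 < N)%N ->
          phi_osp_dot S p (fun=> N) X = \sum_(k < n.+2) N%:R ^+ k *: b k,
        forall k, (k < size p)%N -> b k = 0
      & b (size p) = K n p X].
Proof.
have size_le (q : osp 'I_n.+1) : (size q <= n.+1)%N.
  by have := is_osp_size (blocksP q); rewrite card_ord.
have [m] := ubnP (n.+1 - size p)%N; elim: m p => // m IHm p lt_m.
have /fin_all_exists[b bP] (s : osp 'I_n.+1) : exists b : nat -> B, oplt s p ->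
    [/\ forall N, (0 < N)%N ->
          phi_osp_dot S s (fun=> N) X = \sum_(k < n.+2) N%:R ^+ k *: b k,
        forall k, (k < size s)%N -> b k = 0
      & b (size s) = K n s X].
  case: (boolP (oplt s p)) => [lt_sp|_]; last by exists (fun=> 0).
  have [|b bP] := IHm s; last by exists b.
  have lt_size := oplt_size lt_sp.
  by apply: leq_trans (ltn_sub2l _ lt_size) lt_m; apply: leq_trans lt_size _.
pose low k := \sum_(s | oplt s p) c n s p *: b s k.
have low0 k : (k <= size p)%N -> low k = 0.
  move=> le_k; rewrite /low big1 // => s lt_sp; have [_ b0 _] := bP s lt_sp.
  by rewrite b0 ?scaler0 // (leq_ltn_trans le_k) ?oplt_size.
exists (fun k => (if k == size p then K n p X else 0) - low k); split.
- move=> N N0; have := S3 n p N X N0; rewrite /cumulant_dot.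
  rewrite (bigD1 p) ?ople_refl //= cpp scale1r => /(canRL (addrK _)) ->.
  under [RHS]eq_bigr do rewrite scalerBr.
  rewrite sumrB; congr (_ - _).
    rewrite (bigD1 (Ordinal (size_le p : (size p < n.+2)%N))) //= eqxx.
    rewrite big1 ?addr0 // => k; rewrite -val_eqE /= => /negPf ->.
    exact: scaler0.
  under [RHS]eq_bigr do rewrite scaler_sumr.
  rewrite exchange_big /=; apply: eq_big => [s|s]; rewrite andbC //.
  move=> lt_sp; have [-> // _ _] := bP s lt_sp; rewrite scaler_sumr.
  by apply: eq_bigr => k _; rewrite !scalerA mulrC.
- by move=> k lt_k; rewrite ltn_eqF // low0 ?subr0 // ltnW.
- by rewrite eqxx low0 // subr0.
Qed.

Theorem theorem3p6 (R : realType) (A B : assocAlgType R[i])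
    (phi : {linear A -> B}) (S : spreadability_system phi)
    (K K' : functionals A B)
    (cumK : is_cumulants S K) (cumK' : is_cumulants S K')
    (n : nat) (p : osp 'I_n.+1) :
  K n p =1 K' n p.
Proof.
move=> X.
have [_ [_ [c [cpp _ S3]]]] := cumK; have [_ [_ [c' [cpp' _ S3']]]] := cumK'.
have [b [b_dot _ <-]] := phi_osp_dot_poly cpp S3 X p.
have [b' [b'_dot _ <-]] := phi_osp_dot_poly cpp' S3' X p.
apply: (@eq_coef_nat _ _ n.+2); first exact: Num.Theory.pchar_num.
  by move=> N N0; rewrite -b_dot // b'_dot.
by have := is_osp_size (blocksP p); rewrite card_ord ltnS.
Qed.
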